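(* There is an algorithm which, given a kinding context $\Delta$, a type $T$ of $F^{\mu_*;}_\omega$ and a kind $\kappa$, decides whether $\Delta\vdash T:\kappa$.
   Context: Kinds: proper kinds are $\mathsf{s}$ (session) and $\mathsf{t}$ (functional); kinds are $\kappa ::= \mathsf{s} \mid \mathsf{t} \mid \kappa \Rightarrow \kappa$. Types are $T ::= \iota \mid \alpha \mid \lambda\alpha{:}\kappa.T \mid T\,T$ (application left-associative), $\alpha$ a type variable, $\iota$ a type constant. Constants with their kinds (each $*$ independently $\mathsf{s}$ or $\mathsf{t}$): $\rightarrow\ : *\Rightarrow *\Rightarrow \mathsf{t}$; $\{l_1,\ldots,l_n\}$, $\langle l_1,\ldots,l_n\rangle : *\Rightarrow\cdots\Rightarrow *\Rightarrow\mathsf{t}$ ($n$ arguments); $\mu_\kappa : (\kappa\Rightarrow\kappa)\Rightarrow\kappa$; $\forall_\kappa:(\kappa\Rightarrow * )\Rightarrow\mathsf{t}$; $\mathsf{Skip},\mathsf{End}:\mathsf{s}$; $?,!:*\Rightarrow\mathsf{s}$ (written $\sharp$); $;\,:\mathsf{s}\Rightarrow\mathsf{s}\Rightarrow\mathsf{s}$; $\&\{l_1..l_n\},\oplus\{l_1..l_n\}:\mathsf{s}\Rightarrow\cdots\Rightarrow\mathsf{s}\Rightarrow\mathsf{s}$ ($n$ arguments; written $\odot\{\overline{l_i}\}$); $\mathsf{Dual}:\mathsf{s}\Rightarrow\mathsf{s}$. Notation: $T;U$ is $(;\,T)\,U$; $\odot\{\overline{l_i:T_i}\}$ is $\odot\{\overline{l_i}\}\,T_1\cdots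 T_n$. The class $F^{\mu_*;}_\omega$ consists of the types in which every occurrence of a constant $\mu_\kappa$ has $\kappa\in\{\mathsf{s},\mathsf{t}\}$. Renaming: with a countable well-ordered set of variables $\upsilon_1,\upsilon_2,\ldots$: $\mathrm{rename}_S(\iota)=\iota$, $\mathrm{rename}_S(\alpha)=\alpha$, $\mathrm{rename}_S(\lambda\alpha{:}\kappa.T)=\lambda\upsilon{:}\kappa.\mathrm{rename}_S(T[\upsilon/\alpha])$ with $\upsilon$ the least $\upsilon_i\notin S\cup\mathrm{fv}(\lambda\alpha{:}\kappa.T)$, $\mathrm{rename}_S(T\,U)=\mathrm{rename}_{S\cup\mathrm{fv}(U)}(T)\,\mathrm{rename}_S(U)$; $\mathrm{rename}(T)=\mathrm{rename}_\emptyset(T)$. Convention: all types are renamed. Reduction $\longrightarrow$: least relation closed under $\mathsf{Skip};T \longrightarrow T$; $T\longrightarrow V\Rightarrow T;U\longrightarrow V;U$; $(T;U);V\longrightarrow T;(U;V)$; $\mu_\kappa\,T\longrightarrow T\,(\mu_\kappa\,T)$; $(\lambda\alpha{:}\kappa.T)\,U\longrightarrow \mathrm{rename}(T[U/\alpha])$; $T\longrightarrow U\Rightarrow T\,V\longrightarrow U\,V$; $\mathsf{Dual}(T;U)\longrightarrow (\mathsf{Dual}\,T);(\mathsf{Dual}\,U)$; $\mathsf{Dual}\,\mathsf{Skip}\longrightarrow\mathsf{Skip}$; $\mathsf{Dual}\,\mathsf{End}\longrightarrow\mathsf{End}$; $\mathsf{Dual}(?T)\longrightarrow !T$; $\mathsf{Dual}(!T)\longrightarrow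 ?T$; $\mathsf{Dual}(\&\{\overline{l_i:T_i}\})\longrightarrow\oplus\{\overline{l_i:\mathsf{Dual}\,T_i}\}$; $\mathsf{Dual}(\oplus\{\overline{l_i:T_i}\})\longrightarrow\&\{\overline{l_i:\mathsf{Dual}\,T_i}\}$; $T\longrightarrow U\Rightarrow\mathsf{Dual}\,T\longrightarrow\mathsf{Dual}\,U$; $\mathsf{Dual}(\mathsf{Dual}(\alpha\,T_1\cdots T_m))\longrightarrow \alpha\,T_1\cdots T_m$. Weak head normal form: least predicate with: constants are whnf; $\iota\,T_1\cdots T_m$ ($m\ge1$, $\iota\notin\{;,\mu_\kappa,\mathsf{Dual}\}$) is whnf; $;\,T$ is whnf; $;\,T_1\cdots T_m$ whnf if $m\ge2$, $T_1$ whnf, $T_1$ neither $\mathsf{Skip}$ nor $U;V$; $\alpha\,T_1\cdots T_m$ ($m\ge0$) whnf; $\lambda\alpha{:}\kappa.T$ whnf; $\mathsf{Dual}\,T_1\cdots T_m$ whnf if $m\ge1$, $T_1$ whnf and not $\mathsf{Skip}$, $\mathsf{End}$, $\sharp U$, $U;V$, $\odot\{\overline{l_i:U_i}\}$, $\mathsf{Dual}(\alpha\,U_1\cdots U_n)$. $T\Downarrow$ means there is a whnf $U$ with $T\longrightarrow^*U$. Type formation $\Delta\vdash T:\kappa$ ($\Delta$ a finite map from type variables to kinds; $\Delta+\alpha{:}\kappa$ updates/extends the binding of $\alpha$): $\Delta\vdash\iota:\kappa_\iota$ for each listed kind $\kappa_\iota$ of $\iota$; $\Delta\vdash\alpha:\kappa$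 if $\alpha{:}\kappa\in\Delta$; $\Delta\vdash\lambda\alpha{:}\kappa.T:\kappa\Rightarrow\kappa'$ if $\Delta+\alpha{:}\kappa\vdash T:\kappa'$; $\Delta\vdash T\,U:\kappa'$ if $\Delta\vdash T:\kappa\Rightarrow\kappa'$, $\Delta\vdash U:\kappa$ and $T\,U\Downarrow$. *)

(* Defs.v *)
From mathcomp Require Import all_boot.
From Stdlib Require Import Relations.

Set Implicit Arguments.
Unset Strict Implicit.
Unset Printing Implicit Defensive.

(** * Kinds and types *)

Inductive kind : Type :=
| KS
| KT
| KArr of kind & kind.

Definition proper (k : kind) : bool := if k is KArr _ _ then false else true.

(** The i-th variable of the well-ordered supply is the number i. *)
Definition var := nat.
Definition label := nat.

(** A list of labels fixes the order of the arguments of a record, variant or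
    choice constant; the empty list is allowed. *)
Inductive const : Type :=
| CArrow
| CRecord of seq label
| CVariant of seq label
| CMu of kind
| CForall of kind
| CSkip
| CEnd
| CIn                      (* ? *)
| COut                     (* ! *)
| CSeq                     (* ; *)
| CExternal of seq label   (* & *)
| CInternal of seq label   (* (+) *)
| CDual.

Inductive ty : Type :=
| Con of const
| Var of var
| Lam of var & kind & ty
| App of ty & ty.

Definition apps (T : ty) (Us : seq ty) : ty := foldl App T Us.

Notation Skip := (Con CSkip).
Notation End_ := (Con CEnd).
Notation Dual := (App (Con CDual)).
Notation Seq T U := (App (App (Con CSeq) T) U).

(** A constant may have several kinds: each argument kind written as an
    asterisk in the usual presentation is independently KS or KT. *)
Inductive const_kind : const -> kind -> Prop :=
| ck_arrow k1 k2 : proper k1 -> proper k2 ->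
    const_kind CArrow (KArr k1 (KArr k2 KT))
| ck_record ls ks : size ks = size ls -> all proper ks ->
    const_kind (CRecord ls) (foldr KArr KT ks)
| ck_variant ls ks : size ks = size ls -> all proper ks ->
    const_kind (CVariant ls) (foldr KArr KT ks)
| ck_mu k : const_kind (CMu k) (KArr (KArr k k) k)
| ck_forall k k1 : proper k1 -> const_kind (CForall k) (KArr (KArr k k1) KT)
| ck_skip : const_kind CSkip KS
| ck_end : const_kind CEnd KS
| ck_in k : proper k -> const_kind CIn (KArr k KS)
| ck_out k : proper k -> const_kind COut (KArr k KS)
| ck_seq : const_kind CSeq (KArr KS (KArr KS KS))
| ck_external ls :
    const_kind (CExternal ls) (foldr KArr KS (nseq (size ls) KS))
| ck_internal ls :
    const_kind (CInternal ls) (foldr KArr KS (nseq (size ls) KS))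
| ck_dual : const_kind CDual (KArr KS KS).

(** Membership in the class of types whose recursion is at proper kinds. *)
Fixpoint mu_proper (T : ty) : bool :=
  match T with
  | Con (CMu k) => proper k
  | Con _ | Var _ => true
  | Lam _ _ T1 => mu_proper T1
  | App T1 T2 => mu_proper T1 && mu_proper T2
  end.

(** * Substitution and renaming *)

Fixpoint fv (T : ty) : seq var :=
  match T with
  | Con _ => [::]
  | Var a => [:: a]
  | Lam a _ T1 => [seq b <- fv T1 | b != a]
  | App T1 T2 => fv T1 ++ fv T2
  end.

Definition fresh (s : seq var) : var :=
  find (fun a => a \notin s) (iota 0 (size s).+1).

Lemma freshP (s : seq var) :
  fresh s \notin s /\ forall a, a < fresh s -> a \in s.
Proof.
have h : has (fun a => a \notin s) (iota 0 (size s).+1).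
  apply/negPn/negP => /hasPn all_s.
  have: size (iota 0 (size s).+1) <= size s.
    by apply: uniq_leq_size (iota_uniq _ _) _ => a /all_s /negPn.
  by rewrite size_iota ltnn.
have lt_f : fresh s < (size s).+1 by rewrite -[X in _ < X](size_iota 0) -has_find.
split; first by have := nth_find 0 h; rewrite -/(fresh s) nth_iota.
move=> a lt_a; have := before_find 0 lt_a.
by rewrite nth_iota ?(ltn_trans lt_a lt_f) // => /negbFE.
Qed.

Definition upd (s : var -> ty) (a : var) (U : ty) : var -> ty :=
  fun b => if b == a then U else s b.

(** Capture-avoiding simultaneous substitution; every binder passed is replaced
    by the least variable that cannot capture, so the result is determined. *)
Fixpoint subst (s : var -> ty) (T : ty) : ty :=
  match T with
  | Con c => Con c
  | Var a => s a
  | Lam a k T1 =>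
      let b := fresh (flatten [seq fv (s x) | x <- fv T]) in
      Lam b k (subst (upd s a (Var b)) T1)
  | App T1 T2 => App (subst s T1) (subst s T2)
  end.

(** [subst1 U a T] is T[U/a]. *)
Definition subst1 (U : ty) (a : var) (T : ty) : ty := subst (upd Var a U) T.

Fixpoint tsize (T : ty) : nat :=
  match T with
  | Con _ | Var _ => 1
  | Lam _ _ T1 => (tsize T1).+1
  | App T1 T2 => (tsize T1 + tsize T2).+1
  end.

(** The recursive call under a binder is on a substitution instance, hence the
    bound [n] on the number of calls; [rename_con], [rename_var], [rename_lam]
    and [rename_app] are the intended defining equations. *)
Fixpoint rename_rec (n : nat) (S : seq var) (T : ty) : ty :=
  if n is n'.+1 then
    match T with
    | Con c => Con c
    | Var a => Var a
    | Lam a k T1 =>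
        let b := fresh (S ++ fv T) in
        Lam b k (rename_rec n' S (subst1 (Var b) a T1))
    | App T1 T2 => App (rename_rec n' (S ++ fv T2) T1) (rename_rec n' S T2)
    end
  else T.

Definition rename_in (S : seq var) (T : ty) : ty := rename_rec (tsize T) S T.
Definition rename (T : ty) : ty := rename_in [::] T.
Definition renamed (T : ty) : Prop := rename T = T.

Lemma tsize_subst (s : var -> ty) (T : ty) :
  (forall a, tsize (s a) = 1) -> tsize (subst s T) = tsize T.
Proof.
elim: T s => [c|a|a k T IH|T IHT U IHU] s hs //=; last by rewrite IHT ?IHU.
by rewrite IH // => b; rewrite /upd; case: eqP.
Qed.

Lemma tsize_subst1_var (a b : var) (T : ty) :
  tsize (subst1 (Var b) a T) = tsize T.
Proof. by apply: tsize_subst => c; rewrite /upd; case: eqP. Qed.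

Lemma rename_recE (n : nat) (S : seq var) (T : ty) :
  tsize T <= n -> rename_rec n S T = rename_in S T.
Proof.
rewrite /rename_in.
have gen m : forall n' S' T', tsize T' <= n' -> tsize T' <= m ->
    rename_rec n' S' T' = rename_rec m S' T'.
  elim: m => [|m IH] [|n'] S' [c|a|a k T'|T1 T2] //=; rewrite !ltnS => h1 h2.
    by rewrite (IH n') // tsize_subst1_var.
  congr App; apply: IH.
  - exact: leq_trans (leq_addr _ _) h1.
  - exact: leq_trans (leq_addr _ _) h2.
  - exact: leq_trans (leq_addl _ _) h1.
  - exact: leq_trans (leq_addl _ _) h2.
by move=> h; apply: gen.
Qed.

Lemma rename_con (S : seq var) (c : const) : rename_in S (Con c) = Con c.
Proof. by []. Qed.

Lemma rename_var (S : seq var) (a : var) : rename_in S (Var a) = Var a.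
Proof. by []. Qed.

Lemma rename_lam (S : seq var) (a : var) (k : kind) (T : ty) :
  let b := fresh (S ++ fv (Lam a k T)) in
  rename_in S (Lam a k T) = Lam b k (rename_in S (subst1 (Var b) a T)).
Proof. by rewrite /= {1}/rename_in /= rename_recE // tsize_subst1_var. Qed.

Lemma rename_app (S : seq var) (T U : ty) :
  rename_in S (App T U) = App (rename_in (S ++ fv U) T) (rename_in S U).
Proof. by rewrite {1}/rename_in /= !rename_recE ?leq_addr ?leq_addl. Qed.

(** * Reduction and weak head normal forms *)

Inductive red : ty -> ty -> Prop :=
| red_skip T : red (Seq Skip T) T
| red_seq T V U : red T V -> red (Seq T U) (Seq V U)
| red_assoc T U V : red (Seq (Seq T U) V) (Seq T (Seq U V))
| red_mu k T : red (App (Con (CMu k)) T) (App T (App (Con (CMu k)) T))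
| red_beta a k T U : red (App (Lam a k T) U) (rename (subst1 U a T))
| red_app T U V : red T U -> red (App T V) (App U V)
| red_dual_seq T U : red (Dual (Seq T U)) (Seq (Dual T) (Dual U))
| red_dual_skip : red (Dual Skip) Skip
| red_dual_end : red (Dual End_) End_
| red_dual_in T : red (Dual (App (Con CIn) T)) (App (Con COut) T)
| red_dual_out T : red (Dual (App (Con COut) T)) (App (Con CIn) T)
| red_dual_external ls Ts : size Ts = size ls ->
    red (Dual (apps (Con (CExternal ls)) Ts))
        (apps (Con (CInternal ls)) [seq Dual T | T <- Ts])
| red_dual_internal ls Ts : size Ts = size ls ->
    red (Dual (apps (Con (CInternal ls)) Ts))
        (apps (Con (CExternal ls)) [seq Dual T | T <- Ts])
| red_dual T U : red T U -> red (Dual T) (Dual U)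
| red_dual_dual a Ts :
    red (Dual (Dual (apps (Var a) Ts))) (apps (Var a) Ts).

Definition weak_head_inert (c : const) : bool :=
  match c with CSeq | CMu _ | CDual => false | _ => true end.

Definition is_seq (T : ty) : Prop := exists U V, T = Seq U V.

(** The arguments of Dual that a Dual-rule consumes. *)
Inductive dual_redex_arg : ty -> Prop :=
| dra_skip : dual_redex_arg Skip
| dra_end : dual_redex_arg End_
| dra_in U : dual_redex_arg (App (Con CIn) U)
| dra_out U : dual_redex_arg (App (Con COut) U)
| dra_seq U V : dual_redex_arg (Seq U V)
| dra_external ls Us : size Us = size ls ->
    dual_redex_arg (apps (Con (CExternal ls)) Us)
| dra_internal ls Us : size Us = size ls ->
    dual_redex_arg (apps (Con (CInternal ls)) Us)
| dra_dual a Us : dual_redex_arg (Dual (apps (Var a) Us)).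

Inductive whnf : ty -> Prop :=
| whnf_con c : whnf (Con c)
| whnf_con_apps c Ts : weak_head_inert c -> 0 < size Ts ->
    whnf (apps (Con c) Ts)
| whnf_seq1 T : whnf (App (Con CSeq) T)
| whnf_seq T1 Ts : 0 < size Ts -> whnf T1 -> T1 <> Skip -> ~ is_seq T1 ->
    whnf (apps (Con CSeq) (T1 :: Ts))
| whnf_var a Ts : whnf (apps (Var a) Ts)
| whnf_lam a k T : whnf (Lam a k T)
| whnf_dual T1 Ts : whnf T1 -> ~ dual_redex_arg T1 ->
    whnf (apps (Con CDual) (T1 :: Ts)).

Definition normalises (T : ty) : Prop :=
  exists U, whnf U /\ clos_refl_trans ty red T U.

(** * Type formation *)

(** A finite map is given by an association list in which the first binding of
    a variable is the valid one; consing a binding updates the map. *)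
Definition ctx := seq (var * kind).

Fixpoint lookup (D : ctx) (a : var) : option kind :=
  if D is (b, k) :: D' then if a == b then Some k else lookup D' a else None.

Inductive has_kind : ctx -> ty -> kind -> Prop :=
| hk_con D c k : const_kind c k -> has_kind D (Con c) k
| hk_var D a k : lookup D a = Some k -> has_kind D (Var a) k
| hk_lam D a k k' T : has_kind ((a, k) :: D) T k' ->
    has_kind D (Lam a k T) (KArr k k')
| hk_app D T U k k' : has_kind D T (KArr k k') -> has_kind D U k ->
    normalises (App T U) -> has_kind D (App T U) k'.

(** * Algorithms *)

(** An algorithm is a program in a Turing-complete first-order functional
    language over binary trees (pure LISP, or Jones's language F). A program is
    a list of bodies of mutually recursive one-argument functions; the first is
    its entry point. A function of the metalanguage would not do: under
    classical choice every predicate has a boolean decision function. *)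
Inductive tree : Type :=
| Nil
| Cons of tree & tree.

Definition hd (t : tree) : tree := if t is Cons u _ then u else Nil.
Definition tl (t : tree) : tree := if t is Cons _ u then u else Nil.

Definition code_bool (b : bool) : tree := if b then Cons Nil Nil else Nil.

Inductive expr : Type :=
| EArg
| EQuote of tree
| ECons of expr & expr
| EHd of expr
| ETl of expr
| EEq of expr & expr
| EIf of expr & expr & expr
| ECall of nat & expr.

Definition program := seq expr.

(** [eval p x e v]: in program [p], with the argument of the current function
    equal to [x], the expression [e] evaluates to [v]. Any tree other than
    [Nil] counts as true; calls are by value. *)
Inductive eval (p : program) : tree -> expr -> tree -> Prop :=
| ev_arg x : eval p x EArg x
| ev_quote x t : eval p x (EQuote t) t
| ev_cons x e1 e2 v1 v2 : eval p x e1 v1 -> eval p x e2 v2 ->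
    eval p x (ECons e1 e2) (Cons v1 v2)
| ev_hd x e v : eval p x e v -> eval p x (EHd e) (hd v)
| ev_tl x e v : eval p x e v -> eval p x (ETl e) (tl v)
| ev_eq x e1 e2 v : eval p x e1 v -> eval p x e2 v ->
    eval p x (EEq e1 e2) (code_bool true)
| ev_neq x e1 e2 v1 v2 : eval p x e1 v1 -> eval p x e2 v2 -> v1 <> v2 ->
    eval p x (EEq e1 e2) (code_bool false)
| ev_if_true x e e1 e2 v w : eval p x e v -> v <> Nil -> eval p x e1 w ->
    eval p x (EIf e e1 e2) w
| ev_if_false x e e1 e2 w : eval p x e Nil -> eval p x e2 w ->
    eval p x (EIf e e1 e2) w
| ev_call x f e body v w : eval p x e v -> onth p f = Some body ->
    eval p v body w -> eval p x (ECall f e) w.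

Definition returns (p : program) (input output : tree) : Prop :=
  eval p input (ECall 0 EArg) output.

Lemma eval_det (p : program) (x : tree) (e : expr) (v w : tree) :
  eval p x e v -> eval p x e w -> v = w.
Proof.
move=> ev; elim: ev w => {x e v} /=.
- by move=> x w h; inversion h.
- by move=> x t w h; inversion h.
- by move=> x e1 e2 v1 v2 _ IH1 _ IH2 w h; inversion h; subst; f_equal; auto.
- by move=> x e v _ IH w h; inversion h; subst; f_equal; auto.
- by move=> x e v _ IH w h; inversion h; subst; f_equal; auto.
- move=> x e1 e2 v _ IH1 _ IH2 w h; inversion h; subst => //.
  match goal with ne : _ <> _ |- _ => case: ne end.
  by transitivity v; [symmetry|]; auto.
- move=> x e1 e2 v1 v2 _ IH1 _ IH2 ne w h; inversion h; subst => //.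
  by case: ne; transitivity v; [|symmetry]; auto.
- move=> x e e1 e2 v w _ IH1 ne _ IH2 u h; inversion h; subst; first by auto.
  by case: ne; auto.
- move=> x e e1 e2 w _ IH1 _ IH2 u h; inversion h; subst; last by auto.
  match goal with ne : _ <> Nil |- _ => by case: ne; symmetry; auto end.
- move=> x f e body v w _ IH1 pf _ IH2 u h; inversion h; subst.
  match goal with h1 : eval p x e ?v', h2 : onth p f = _ |- _ =>
    have ? := IH1 _ h1; subst v'; move: h2; rewrite pf => -[?]; subst end.
  by auto.
Qed.

(** * Encoding of inputs as trees *)

Fixpoint code_nat (n : nat) : tree :=
  if n is n'.+1 then Cons Nil (code_nat n') else Nil.

Definition code_seq (ts : seq tree) : tree := foldr Cons Nil ts.

Definition node (tag : nat) (ts : seq tree) : tree :=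
  Cons (code_nat tag) (code_seq ts).

Fixpoint code_kind (k : kind) : tree :=
  match k with
  | KS => node 0 [::]
  | KT => node 1 [::]
  | KArr k1 k2 => node 2 [:: code_kind k1; code_kind k2]
  end.

Definition code_const (c : const) : tree :=
  let labels (ls : seq label) := code_seq [seq code_nat l | l <- ls] in
  match c with
  | CArrow => node 0 [::]
  | CRecord ls => node 1 [:: labels ls]
  | CVariant ls => node 2 [:: labels ls]
  | CMu k => node 3 [:: code_kind k]
  | CForall k => node 4 [:: code_kind k]
  | CSkip => node 5 [::]
  | CEnd => node 6 [::]
  | CIn => node 7 [::]
  | COut => node 8 [::]
  | CSeq => node 9 [::]
  | CExternal ls => node 10 [:: labels ls]
  | CInternal ls => node 11 [:: labels ls]
  | CDual => node 12 [::]
  end.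

Fixpoint code_ty (T : ty) : tree :=
  match T with
  | Con c => node 0 [:: code_const c]
  | Var a => node 1 [:: code_nat a]
  | Lam a k T1 => node 2 [:: code_nat a; code_kind k; code_ty T1]
  | App T1 T2 => node 3 [:: code_ty T1; code_ty T2]
  end.

Definition code_ctx (D : ctx) : tree :=
  code_seq [seq Cons (code_nat b.1) (code_kind b.2) | b <- D].

Definition code_input (D : ctx) (T : ty) (k : kind) : tree :=
  code_seq [:: code_ctx D; code_ty T; code_kind k].

(* Main.v *)
From mathcomp Require Import all_boot.
Require Import Defs.
From Stdlib Require Import Relations Setoid Classical.

Set Implicit Arguments.
Unset Strict Implicit.
Unset Printing Implicit Defensive.

(** Only the kinds of the constants, which are finitely ambiguous, and the
    condition that [T U] normalises need an algorithm. For the latter, interpret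
    a type of proper kind in the flat domain with elements "diverges", "reaches
    Skip" and "reaches another normal form". There [Dual] is the identity,
    [T;U] is [U] if [T] is Skip and [T] otherwise, every other constant and every
    free variable absorbs its arguments, and the least fixed point of a monotone
    [F] on a flat domain is [F] applied to bottom. So recursion at proper kinds
    disappears: what remains is a simply typed term, which a call-by-value
    interpreter evaluates to its value in the domain. Termination and adequacy
    of the interpreter are proved at once, by a logical relation indexed by the
    number of unfoldings of recursion. *)

(** * De Bruijn terms *)

Inductive dty : Type :=
| DCon of const
| DVar of nat
| DLam of dty
| DApp of dty & dty.

Definition scons {A : Type} (x : A) (f : nat -> A) (i : nat) : A :=
  if i is j.+1 then f j else x.

Fixpoint ren (r : nat -> nat) (t : dty) : dty :=
  match t with
  | DCon c => DCon c
  | DVar i => DVar (r i)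
  | DLam t1 => DLam (ren (scons 0 (S \o r)) t1)
  | DApp t1 t2 => DApp (ren r t1) (ren r t2)
  end.

Definition up (f : nat -> dty) : nat -> dty := scons (DVar 0) (ren S \o f).

Fixpoint dsubst (f : nat -> dty) (t : dty) : dty :=
  match t with
  | DCon c => DCon c
  | DVar i => f i
  | DLam t1 => DLam (dsubst (up f) t1)
  | DApp t1 t2 => DApp (dsubst f t1) (dsubst f t2)
  end.

Definition dsubst1 (u t : dty) : dty := dsubst (scons u DVar) t.

Definition dupd (s : var -> dty) (a : var) (u : dty) : var -> dty :=
  fun x => if x == a then u else s x.

Definition bind (s : var -> dty) (a : var) : var -> dty :=
  dupd (ren S \o s) a (DVar 0).

(** Named variables are sent to de Bruijn terms by [s]; with [s := DVar] this
    forgets the bound names, and alpha-equivalent types get equal images. *)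
Fixpoint inst (s : var -> dty) (T : ty) : dty :=
  match T with
  | Con c => DCon c
  | Var a => s a
  | Lam a _ T1 => DLam (inst (bind s a) T1)
  | App T1 T2 => DApp (inst s T1) (inst s T2)
  end.

(** * Laws of renaming, substitution and translation of named types *)

Lemma ren_ext (r r' : nat -> nat) (t : dty) : r =1 r' -> ren r t = ren r' t.
Proof.
elim: t r r' => [c|i|t IH|t IHt u IHu] r r' e //=; first by rewrite e.
  by congr DLam; apply: IH => -[|i] //=; rewrite e.
by rewrite (IHt _ _ e) (IHu _ _ e).
Qed.

Lemma dsubst_ext (f g : nat -> dty) (t : dty) :
  f =1 g -> dsubst f t = dsubst g t.
Proof.
elim: t f g => [c|i|t IH|t IHt u IHu] f g e //=.
  by congr DLam; apply: IH => -[|i] //=; rewrite e.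
by rewrite (IHt _ _ e) (IHu _ _ e).
Qed.

Lemma inst_ext (s s' : var -> dty) (T : ty) :
  {in fv T, s =1 s'} -> inst s T = inst s' T.
Proof.
elim: T s s' => [c|a|a k T IH|T IHT U IHU] s s' e //=.
- by apply: e; rewrite inE.
- congr DLam; apply: IH => x xT; rewrite /bind /dupd; case: eqP => //= /eqP xa.
  by rewrite e //= mem_filter xa.
- by rewrite (IHT s s') 1?(IHU s s') // => x xT; apply: e; rewrite mem_cat xT ?orbT.
Qed.

Lemma ren_ren (r r' : nat -> nat) (t : dty) : ren r (ren r' t) = ren (r \o r') t.
Proof.
elim: t r r' => [c|i|t IH|t IHt u IHu] r r' //=; last by rewrite IHt IHu.
by rewrite IH; congr DLam; apply: ren_ext => -[].
Qed.

Lemma ren_S (r : nat -> nat) (t : dty) :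
  ren (scons 0 (S \o r)) (ren S t) = ren S (ren r t).
Proof. by rewrite !ren_ren; apply: ren_ext. Qed.

Lemma dsubst_ren (f : nat -> dty) (r : nat -> nat) (t : dty) :
  dsubst f (ren r t) = dsubst (f \o r) t.
Proof.
elim: t f r => [c|i|t IH|t IHt u IHu] f r //=; last by rewrite IHt IHu.
by rewrite IH; congr DLam; apply: dsubst_ext => -[].
Qed.

Lemma ren_dsubst (r : nat -> nat) (f : nat -> dty) (t : dty) :
  ren r (dsubst f t) = dsubst (ren r \o f) t.
Proof.
elim: t f r => [c|i|t IH|t IHt u IHu] f r //=; last by rewrite IHt IHu.
by rewrite IH; congr DLam; apply: dsubst_ext => -[|i] //=; apply: ren_S.
Qed.

Lemma dsubst_id (t : dty) : dsubst DVar t = t.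
Proof.
elim: t => [c|i|t IH|t IHt u IHu] //=; last by rewrite IHt IHu.
congr DLam; rewrite -[RHS]IH.
by apply: dsubst_ext => -[].
Qed.

Lemma dsubst_inst (f : nat -> dty) (s : var -> dty) (T : ty) :
  dsubst f (inst s T) = inst (dsubst f \o s) T.
Proof.
elim: T f s => [c|a|a k T IH|T IHT U IHU] f s //=; last by rewrite IHT IHU.
rewrite IH; congr DLam; apply: inst_ext => x _ /=.
by rewrite /bind /dupd; case: eqP => //= _; rewrite dsubst_ren ren_dsubst.
Qed.

Lemma ren_inst (r : nat -> nat) (s : var -> dty) (T : ty) :
  ren r (inst s T) = inst (ren r \o s) T.
Proof.
elim: T r s => [c|a|a k T IH|T IHT U IHU] r s //=; last by rewrite IHT IHU.
rewrite IH; congr DLam; apply: inst_ext => x _ /=.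
by rewrite /bind /dupd; case: eqP => //= _; apply: ren_S.
Qed.

Lemma inst_bind (s : var -> dty) (b : var) (T : ty) :
  b \notin fv T -> inst (bind s b) T = ren S (inst s T).
Proof.
move=> bT; rewrite ren_inst; apply: inst_ext => x xT.
by rewrite /bind /dupd; case: eqP => // e; rewrite -e xT in bT.
Qed.

(** Under a binder, the fresh name chosen by [subst] is free in no [s x] with [x] free in the
    abstraction, so by [inst_bind] binding it acts on these images as a mere shift. *)
Lemma inst_subst (s' : var -> dty) (s : var -> ty) (T : ty) :
  inst s' (subst s T) = inst (inst s' \o s) T.
Proof.
elim: T s' s => [c|a|a k T IH|T IHT U IHU] s' s //=; last by rewrite IHT IHU.
set b := fresh _; rewrite IH; congr DLam; apply: inst_ext => x xT /=.
rewrite /upd {2}/bind /dupd; case: eqP => [_|/eqP xa] /=.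
  by rewrite /bind /dupd eqxx.
apply: inst_bind; have [+ _] := freshP (flatten [seq fv (s y) | y <- fv (Lam a k T)]).
apply: contra => bsx; apply/flatten_mapP; exists x => //=.
by rewrite mem_filter xa.
Qed.

(** Renaming changes bound names only, which the translation forgets. The induction is on size,
    because [rename_in] recurses on a substitution instance of the body. *)
Lemma inst_rename_in (S : seq var) (s : var -> dty) (T : ty) :
  inst s (rename_in S T) = inst s T.
Proof.
have [n] := ubnP (tsize T); elim: n S s T => // n IH S s [c|a|a k T|T U].
- by rewrite rename_con.
- by rewrite rename_var.
- rewrite rename_lam /= ltnS => lt_n; set b := fresh _.
  rewrite IH ?tsize_subst1_var // inst_subst; congr DLam; apply: inst_ext => x xT /=.
  rewrite /upd {2}/bind /dupd; case: eqP => [_|/eqP xa] /=.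
    by rewrite /bind /dupd eqxx.
  rewrite /bind /dupd; case: eqP => // xb.
  have [/negP + _] := freshP (S ++ fv (Lam a k T)); case.
  by rewrite -/b mem_cat /= mem_filter -xb xa xT orbT.
- rewrite rename_app /= ltnS => lt_n; rewrite !IH //.
    exact: leq_ltn_trans (leq_addl _ _) lt_n.
  exact: leq_ltn_trans (leq_addr _ _) lt_n.
Qed.

Lemma dsubst1_inst (s : var -> dty) (a : var) (u : dty) (T : ty) :
  dsubst1 u (inst (bind s a) T) = inst (dupd s a u) T.
Proof.
rewrite /dsubst1 dsubst_inst; apply: inst_ext => x _ /=.
rewrite /bind /dupd; case: eqP => //= _.
by rewrite dsubst_ren -[RHS]dsubst_id; apply: dsubst_ext.
Qed.

(** This turns the named beta rule, with its renaming, into plain de Bruijn beta; from here on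
    renaming no longer has to be followed. *)
Lemma inst_beta (s : var -> dty) (a : var) (U T : ty) :
  inst s (rename (subst1 U a T)) = dsubst1 (inst s U) (inst (bind s a) T).
Proof.
rewrite dsubst1_inst inst_rename_in inst_subst; apply: inst_ext => x _ /=.
by rewrite /upd /dupd; case: eqP.
Qed.

(** * Evaluation to weak head normal form *)

Definition is_skip (c : const) : bool := if c is CSkip then true else false.

(** [whev n t us b]: with at most [n] nested unfoldings of recursion, [t] applied
    to the arguments [us] has a weak head normal form, which is [Skip] exactly
    when [b] is true. Being directed by the head of [t], this is deterministic,
    whereas [red] is not even confluent: [((A;B);U);V] reduces both to
    [A;((B;U);V)] and to [A;(B;(U;V))]. *)
Inductive whev : nat -> dty -> seq dty -> bool -> Prop :=
| whev_app n t u us b : whev n t (u :: us) b -> whev n (DApp t u) us b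
| whev_var n i us : whev n (DVar i) us false
| whev_lam n t : whev n (DLam t) [::] false
| whev_beta n t u us b :
    whev n (dsubst1 u t) us b -> whev n (DLam t) (u :: us) b
| whev_inert n c us : weak_head_inert c ->
    whev n (DCon c) us (is_skip c && nilp us)
| whev_con n c : ~~ weak_head_inert c -> whev n (DCon c) [::] false
| whev_seq1 n t : whev n (DCon CSeq) [:: t] false
| whev_seq_skip n t u us b : whev n t [::] true -> whev n u us b ->
    whev n (DCon CSeq) [:: t, u & us] b
| whev_seq n t u us : whev n t [::] false ->
    whev n (DCon CSeq) [:: t, u & us] false
| whev_mu n k t us b : whev n t (DApp (DCon (CMu k)) t :: us) b ->
    whev n.+1 (DCon (CMu k)) (t :: us) b
| whev_dual n t us b : whev n t [::] b ->
    whev n (DCon CDual) (t :: us) (b && nilp us).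

Lemma whev_appE (n : nat) (t u : dty) (us : seq dty) (b : bool) :
  whev n (DApp t u) us b <-> whev n t (u :: us) b.
Proof. by split=> h; [inversion h | constructor]. Qed.

Lemma whev_inertE (n : nat) (c : const) (us : seq dty) (b : bool) :
  weak_head_inert c -> whev n (DCon c) us b <-> b = is_skip c && nilp us.
Proof.
move=> ic; split=> [h|->]; last by constructor.
inversion h; subst => //.
by match goal with H : is_true (~~ _) |- _ => rewrite ic in H end.
Qed.

Lemma whev_seqE (n : nat) (t u : dty) (us : seq dty) (b : bool) :
  whev n (DCon CSeq) [:: t, u & us] b <->
  (whev n t [::] true /\ whev n u us b) \/ (whev n t [::] false /\ b = false).
Proof.
split=> [h|[[h1 h2]|[h ->]]]; [|exact: whev_seq_skip|exact: whev_seq].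
by inversion h; subst; auto.
Qed.

Lemma whev_dualE (n : nat) (t : dty) (us : seq dty) (b : bool) :
  whev n (DCon CDual) (t :: us) b <-> exists2 c, whev n t [::] c & b = c && nilp us.
Proof.
split=> [h|[c ? ->]]; last by constructor.
by inversion h; subst => //; exists b0.
Qed.

Lemma whev_mono (n m : nat) (t : dty) (us : seq dty) (b : bool) :
  n <= m -> whev n t us b -> whev m t us b.
Proof.
move=> le_nm e; elim: e m le_nm => {n t us b}; try by move=> *; constructor; auto.
by move=> n k t us b _ IH [|m] // le_nm; constructor; apply: IH.
Qed.

Lemma whev_det (n m : nat) (t : dty) (us : seq dty) (b c : bool) :
  whev n t us b -> whev m t us c -> b = c.
Proof.
move=> e; elim: e m c => {n t us b}.
- by move=> n t u us b _ IH m c h; inversion h; eauto.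
- by move=> n i us m c h; inversion h.
- by move=> n t m c h; inversion h.
- by move=> n t u us b _ IH m c h; inversion h; subst; eauto.
- by move=> n c us ic m b; rewrite whev_inertE.
- move=> n c ic m b h; inversion h; subst => //.
  by match goal with H : is_true (weak_head_inert _) |- _ => rewrite H in ic end.
- by move=> n t m c h; inversion h.
- move=> n t u us b _ IH1 _ IH2 m c; rewrite whev_seqE => -[[_]|[/IH1]] //.
  exact: IH2.
- by move=> n t u us _ IH m c; rewrite whev_seqE => -[[/IH]|[_ ->]].
- by move=> n k t us b _ IH m c h; inversion h; subst => //; eauto.
- by move=> n t us b _ IH m c; rewrite whev_dualE => -[d /IH -> ->].
Qed.

Lemma whev_apps (n : nat) (s : var -> dty) (T : ty) (Ts : seq ty) us b :
  whev n (inst s (apps T Ts)) us b <-> whev n (inst s T) (map (inst s) Ts ++ us) b.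
Proof.
elim: Ts T => [|U Ts IH] T //=; rewrite IH /=.
by split=> h; [inversion h; subst | constructor].
Qed.

(** * From reduction to evaluation *)

Definition normal_form_is_skip (T : ty) : bool :=
  if T is Con c then is_skip c else false.

Lemma apps_rcons (T U : ty) (Ts : seq ty) : apps T (rcons Ts U) = App (apps T Ts) U.
Proof. by rewrite /apps foldl_rcons. Qed.

Lemma is_skip_apps (T : ty) (Ts : seq ty) :
  0 < size Ts -> normal_form_is_skip (apps T Ts) = false.
Proof. by case/lastP: Ts => // Ts U _; rewrite apps_rcons. Qed.

Lemma is_skipP (T : ty) : normal_form_is_skip T -> T = Skip.
Proof. by case: T => // -[]. Qed.

(** The hypothesis on [s] makes the images of free variables neutral: they absorb all arguments and
    never become [Skip]. *)
Lemma whnf_whev (s : var -> dty) (T : ty) (n : nat) :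
  (forall a us n b, whev n (s a) us b <-> b = false) ->
  whnf T -> whev n (inst s T) [::] (normal_form_is_skip T).
Proof.
move=> hs; elim=> {T} /=.
- move=> c; case ic: (weak_head_inert c).
    by rewrite -[is_skip c]andbT; constructor.
  by case: c ic => //= *; constructor.
- move=> c Ts ic Ts0; rewrite is_skip_apps // whev_apps cats0 /=.
  have -> : false = is_skip c && nilp (map (inst s) Ts).
    by rewrite /nilp size_map; case: (size Ts) Ts0 => // *; rewrite andbF.
  exact: whev_inert.
- by move=> T; do 2 constructor.
- move=> T Ts Ts0 _ IH nskip _; 
  have /= -> := @is_skip_apps (Con CSeq) (T :: Ts) isT.
  apply/(@whev_apps _ _ (Con CSeq) (T :: Ts)) => /=; rewrite cats0.
  case: Ts Ts0 => // U Ts _ /=. apply/whev_seq; move: IH.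
  by case e: (normal_form_is_skip T) => // _; case: nskip; apply: is_skipP.
- move=> a Ts; have -> : normal_form_is_skip (apps (Var a) Ts) = false.
    by case: Ts => // *; rewrite is_skip_apps.
  by rewrite whev_apps /= hs.
- by move=> a k T; constructor.
- move=> T Ts _ IH nred; 
  have /= -> := @is_skip_apps (Con CDual) (T :: Ts) isT.
  apply/(@whev_apps _ _ (Con CDual) (T :: Ts)) => /=; rewrite cats0.
  have e : normal_form_is_skip T = false.
    by apply/negP => /is_skipP e; apply: nred; rewrite e; constructor.
  by apply/whev_dualE; exists false => //; rewrite -e.
Qed.

(** Evaluation is closed under expansion, which replaces confluence: a reduction path to a normal
    form is followed backwards. Only the [red_mu] rule itself costs an additional unfolding. *)
Lemma red_whev (s : var -> dty) (T T' : ty) :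
  (forall a us n b, whev n (s a) us b <-> b = false) ->
  red T T' -> forall us n b, whev n (inst s T') us b ->
  exists m, whev m (inst s T) us b.
Proof.
move=> hs.
have sE n a Ts us b : whev n (inst s (apps (Var a) Ts)) us b <-> b = false.
  by rewrite whev_apps /= hs.
have cE n c Ts us b : 0 < size Ts -> weak_head_inert c ->
    whev n (inst s (apps (Con c) Ts)) us b <-> b = false.
  move=> Ts0 ic; rewrite whev_apps /= whev_inertE //.
  by case: Ts Ts0 => // *; rewrite /nilp /= andbF.
elim=> {T T'}.
- move=> T us n b e; exists n; rewrite /= !whev_appE whev_seqE; left.
  by split=> //; apply/whev_inertE.
- move=> T V U _ IH us n b /=; rewrite !whev_appE whev_seqE.
  case=> [[/IH[m e1] e2]|[/IH[m e] ->]]; last first.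
    by exists m; rewrite !whev_appE whev_seqE; right.
  exists (maxn m n); rewrite !whev_appE whev_seqE; left.
  by split; [apply: whev_mono e1; rewrite leq_maxl | apply: whev_mono e2; rewrite leq_maxr].
- move=> T U V us n b /= h; exists n; move: h.
  rewrite !whev_appE !whev_seqE !whev_appE !whev_seqE; tauto.
- move=> k T us n b /=; rewrite whev_appE => h.
  by exists n.+1; rewrite whev_appE; constructor.
- move=> a k T U us n b; rewrite inst_beta => h; exists n; do 2 constructor.
  exact: h.
- by move=> T U V _ IH us n b /=; rewrite whev_appE => /IH[m e]; exists m; constructor.
- move=> T U us n b /= h; exists n; move: h.
  rewrite !whev_appE whev_seqE !whev_appE !whev_dualE /=.
  case=> [[[c e1 c1] [d e2 ->]]|[[c e1 c1] ->]].
    exists d => //; rewrite !whev_appE whev_seqE; left.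
    by rewrite andbT in c1; rewrite c1.
  rewrite andbT in c1; exists false => //; rewrite !whev_appE whev_seqE; right.
  by rewrite c1.
- move=> us n b /=; rewrite whev_inertE // => ->; exists n.
  by rewrite whev_appE whev_dualE; exists true; rewrite ?whev_inertE.
- move=> us n b /=; rewrite whev_inertE // => ->; exists n.
  by rewrite whev_appE whev_dualE; exists false; rewrite ?whev_inertE.
- move=> T us n b /=; rewrite whev_appE whev_inertE // => ->; exists n.
  by rewrite whev_appE whev_dualE; exists false => //; rewrite whev_appE whev_inertE.
- move=> T us n b /=; rewrite whev_appE whev_inertE // => ->; exists n.
  by rewrite whev_appE whev_dualE; exists false => //; rewrite whev_appE whev_inertE.
- move=> ls Ts _ us n b; rewrite whev_apps /= whev_inertE //= => ->; exists n.
  rewrite /= whev_appE whev_dualE; exists false => //.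
  by rewrite whev_apps whev_inertE.
- move=> ls Ts _ us n b; rewrite whev_apps /= whev_inertE //= => ->; exists n.
  rewrite /= whev_appE whev_dualE; exists false => //.
  by rewrite whev_apps whev_inertE.
- move=> T U _ IH us n b /=; rewrite whev_appE whev_dualE => -[c /IH[m e] ->].
  by exists m; rewrite whev_appE; constructor.
- move=> a Ts us n b /sE ->; exists n.
  rewrite /= whev_appE whev_dualE; exists false => //.
  by rewrite whev_appE whev_dualE; exists false => //; rewrite sE.
Qed.

(** * From evaluation to reduction *)

Lemma reds_app (T T' U : ty) :
  clos_refl_trans ty red T T' -> clos_refl_trans ty red (App T U) (App T' U).
Proof.
elim=> [x y h|x|x y z _ h1 _ h2]; [exact/rt_step/red_app | exact: rt_refl |].
exact: rt_trans h1 h2.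
Qed.

Lemma reds_apps (T T' : ty) (Ts : seq ty) :
  clos_refl_trans ty red T T' -> clos_refl_trans ty red (apps T Ts) (apps T' Ts).
Proof. by elim: Ts T T' => //= U Ts IH T T' h; apply/IH/reds_app. Qed.

Lemma reds_seq (T T' U : ty) :
  clos_refl_trans ty red T T' -> clos_refl_trans ty red (Seq T U) (Seq T' U).
Proof.
elim=> [x y h|x|x y z _ h1 _ h2]; [exact/rt_step/red_seq | exact: rt_refl |].
exact: rt_trans h1 h2.
Qed.

Lemma reds_dual (T T' : ty) :
  clos_refl_trans ty red T T' -> clos_refl_trans ty red (Dual T) (Dual T').
Proof.
elim=> [x y h|x|x y z _ h1 _ h2]; [exact/rt_step/red_dual | exact: rt_refl |].
exact: rt_trans h1 h2.
Qed.

Fixpoint head (T : ty) : ty := if T is App T1 _ then head T1 else T.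

Lemma head_apps (T : ty) (Ts : seq ty) : head (apps T Ts) = head T.
Proof. by elim: Ts T => //= U Ts IH T; rewrite IH. Qed.

Lemma head_neq_seq (T : ty) : head T <> Con CSeq -> ~ is_seq T.
Proof. by move=> h [U [V e]]; apply: h; rewrite e. Qed.

Lemma head_neq_skip (T : ty) : head T <> Skip -> T <> Skip.
Proof. by move=> h e; apply: h; rewrite e. Qed.

(** The condition [head T = T] says that [T] is not an application, so that the spine of [Seq U V]
    is determined. *)
Lemma apps_eq_Seq (T U V : ty) (Ts : seq ty) :
  apps T Ts = Seq U V -> head T = T -> T = Con CSeq /\ Ts = [:: U; V].
Proof.
case/lastP: Ts => [|Ts V']; first by move=> /= ->.
rewrite apps_rcons => -[+ <-]; case/lastP: Ts => [|Ts U']; first by move=> /= ->.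
rewrite apps_rcons => -[+ <-]; case/lastP: Ts => [|Ts T']; first by move=> /= ->.
by rewrite apps_rcons.
Qed.

Lemma whnf_SeqE (T U : ty) : whnf (Seq T U) ->
  [/\ whnf T, T <> Skip & ~ is_seq T].
Proof.
move eS: (Seq T U) => S h; case: h eS => //.
- by move=> c Ts ic _ /esym /apps_eq_Seq [] // [e]; rewrite e in ic.
- by move=> T1 Ts _ w n s /esym /(@apps_eq_Seq _ _ _ (T1 :: Ts)) [] // _ [<- _].
- by move=> a Ts /esym /apps_eq_Seq [].
- by move=> T1 Ts _ _ /esym /(@apps_eq_Seq (Con CDual) _ _ (T1 :: Ts)) [].
Qed.

Lemma whnf_inert_apps (c : const) (Ts : seq ty) :
  weak_head_inert c -> whnf (apps (Con c) Ts).
Proof. by move=> ic; case: Ts => [|T Ts]; [constructor | apply: whnf_con_apps]. Qed.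

Lemma apps_cat (T : ty) (Ts Us : seq ty) : apps T (Ts ++ Us) = apps (apps T Ts) Us.
Proof. exact: foldl_cat. Qed.

(** In the remaining cases the Dual-rule yields a term headed by an inert constant or a variable,
    which stays normal under further arguments. *)
Lemma dual_redex_step (T : ty) : T <> Skip -> ~ is_seq T -> dual_redex_arg T ->
  exists W, [/\ forall Ts, whnf (apps W Ts), red (Dual T) W,
    head W <> Con CSeq & head W <> Skip].
Proof.
move=> nT sT r; case: r nT sT => [|||U|U V|ls Us e|ls Us e|a Us] //.
- by exists End_; split=> // [Us|]; [apply: whnf_inert_apps | constructor].
- move=> U _ _; exists (App (Con COut) U); split=> // [Us|]; last by constructor.
  exact: (@whnf_inert_apps COut (U :: Us)).
- move=> _ _; exists (App (Con CIn) U); split=> // [Us|]; last by constructor.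
  exact: (@whnf_inert_apps CIn (U :: Us)).
- by move=> _ []; exists U, V.
- move=> _ _; exists (apps (Con (CInternal ls)) [seq Dual T | T <- Us]).
  rewrite head_apps; split=> // [Ts|]; last by constructor.
  by rewrite -apps_cat; apply: whnf_inert_apps.
- move=> _ _; exists (apps (Con (CExternal ls)) [seq Dual T | T <- Us]).
  rewrite head_apps; split=> // [Ts|]; last by constructor.
  by rewrite -apps_cat; apply: whnf_inert_apps.
- move=> _ _; exists (apps (Var a) Us).
  rewrite head_apps; split=> // [Ts|]; last by constructor.
  by rewrite -apps_cat; apply: whnf_var.
Qed.

Lemma whnf_dual_nonseq (T : ty) : whnf T -> T <> Skip -> ~ is_seq T ->
  exists W, [/\ forall Ts, whnf (apps W Ts), clos_refl_trans ty red (Dual T) W,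
    ~ is_seq W & W <> Skip].
Proof.
move=> wT nT sT; case: (classic (dual_redex_arg T)) => [r|nr].
  have [W [h1 h2 /head_neq_seq h3 /head_neq_skip h4]] := dual_redex_step nT sT r.
  by exists W; split=> //; apply: rt_step.
exists (Dual T); split=> //; last by case=> ? [].
  by move=> Ts; apply: whnf_dual.
exact: rt_refl.
Qed.

(** For [T] of the form [Seq U V], distribute [Dual] and normalise [Dual U]. Since [U] is normal and
    not a sequence, the result is not a sequence either, and no reassociation is due. *)
Lemma whnf_dual_normalises (T : ty) (Ts : seq ty) : whnf T -> T <> Skip ->
  exists W, [/\ whnf (apps W Ts), clos_refl_trans ty red (Dual T) W & W <> Skip].
Proof.
move=> wT nT; case: (classic (is_seq T)) => [[U [V e]]|sT]; last first.
  by have [W [h1 h2 _ h3]] := whnf_dual_nonseq wT nT sT; exists W; split.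
rewrite e in wT *; have [wU nU sU] := whnf_SeqE wT.
have [W [h1 h2 h3 h4]] := whnf_dual_nonseq wU nU sU.
exists (Seq W (Dual V)); split=> //.
  exact: (@whnf_seq W (Dual V :: Ts) isT (h1 [::]) h4 h3).
exact: rt_trans (rt_step _ _ _ _ (red_dual_seq _ _)) (reds_seq _ h2).
Qed.

(** One reassociation suffices, because the left component of a normal sequence is not itself a
    sequence. *)
Lemma whnf_seq_normalises (T U : ty) (Ts : seq ty) : whnf T -> T <> Skip ->
  exists2 W, whnf (apps W Ts) & clos_refl_trans ty red (Seq T U) W /\ W <> Skip.
Proof.
move=> wT nT; case: (classic (is_seq T)) => [[A [B e]]|sT]; last first.
  exists (Seq T U); first exact: (@whnf_seq T (U :: Ts)).
  by split=> //; apply: rt_refl.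
rewrite e in wT *; have [wA nA sA] := whnf_SeqE wT.
exists (Seq A (Seq B U)); first exact: (@whnf_seq A (Seq B U :: Ts)).
by split=> //; apply/rt_step/red_assoc.
Qed.

Lemma apps_neq_skip (T : ty) (Ts : seq ty) :
  T <> Skip -> normal_form_is_skip (apps T Ts) = false.
Proof.
case: Ts => [|U Ts] nT; last by rewrite is_skip_apps.
by apply/negP => /is_skipP.
Qed.

(** Evaluation prescribes a reduction strategy, replayed here on named types. Quantifying over all
    named preimages lets the induction pass through beta, where [inst_beta] supplies a preimage of
    the contractum. *)
Lemma whev_reds (n : nat) (t : dty) (us : seq dty) (b : bool) (T : ty) (Ts : seq ty) :
  whev n t us b -> inst DVar T = t -> map (inst DVar) Ts = us ->
  exists W, [/\ whnf W, clos_refl_trans ty red (apps T Ts) W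
    & normal_form_is_skip W = b].
Proof.
move=> h; elim: h T Ts => {n t us b}.
- move=> n t u us b _ IH [] // T U Ts [eT eU] eTs.
  by apply: (IH T (U :: Ts)) => //=; rewrite eU eTs.
- move=> n i us [] // a Ts _ _; exists (apps (Var a) Ts); split.
  + exact: whnf_var.
  + exact: rt_refl.
  + exact: apps_neq_skip.
- move=> n t [] // a k T [] // _ _; exists (Lam a k T); split=> //; last exact: rt_refl.
  exact: whnf_lam.
- move=> n t u us b _ IH [] // a k T [|U Ts] //= [eT] [eU eTs].
  have [|W [h1 h2 h3]] := IH (rename (subst1 U a T)) Ts _ eTs.
    by rewrite inst_beta eU eT.
  exists W; split=> //; apply: rt_trans h2; apply/reds_apps/rt_step.
  exact: red_beta.
- move=> n c us ic [] // _ Ts [->] <-; exists (apps (Con c) Ts); split.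
  + exact: whnf_inert_apps.
  + exact: rt_refl.
  + by case: Ts => [|T Ts]; [rewrite andbT | rewrite is_skip_apps ?andbF].
- move=> n c ic [] // _ [] // [->] _; exists (Con c); split.
  + exact: whnf_con.
  + exact: rt_refl.
  + by case: c ic.
- move=> n t [] // _ [|T []] // [->] _; exists (App (Con CSeq) T); split=> //.
  + exact: whnf_seq1.
  + exact: rt_refl.
- move=> n t u us b _ IH1 _ IH2 [] // _ [|T [|U Ts]] // [->] [eT eU eTs].
  have [//|//|W1 [_ r1 /is_skipP e1]] := IH1 T [::]; rewrite {}e1 in r1.
  have [//|//|W [w r2 e2]] := IH2 U Ts.
  exists W; split=> //; apply: rt_trans r2; apply: (@reds_apps (Seq T U)).
  exact: rt_trans (reds_seq _ r1) (rt_step _ _ _ _ (red_skip _)).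
- move=> n t u us _ IH [] // _ [|T [|U Ts]] // [->] [eT eU eTs].
  have [//|//|W1 [w1 r1 e1]] := IH T [::].
  have n1 : W1 <> Skip by move=> e; rewrite e in e1.
  have [W w [r2 nW]] := whnf_seq_normalises U Ts w1 n1.
  exists (apps W Ts); split=> //; last exact: apps_neq_skip.
  exact: (@reds_apps (Seq T U)) (rt_trans _ _ _ _ _ (reds_seq _ r1) r2).
- move=> n k t us b _ IH [] // _ [|T Ts] // [->] [eT eTs].
  have [//||W [w r e]] := IH T (App (Con (CMu k)) T :: Ts).
    by rewrite /= eT eTs.
  exists W; split=> //; apply: rt_trans r.
  by apply: (@reds_apps (App _ _) (App _ _)); apply/rt_step/red_mu.
- move=> n t us b _ IH [] // _ [|T Ts] // [->] [eT eTs].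
  have [//|//|W1 [w1 r1 e1]] := IH T [::].
  case: b e1 {IH} => e1 /=; last first.
    have n1 : W1 <> Skip by move=> e; rewrite e in e1.
    have [W [w r nW]] := whnf_dual_normalises Ts w1 n1.
    exists (apps W Ts); split=> //; last exact: apps_neq_skip.
    exact: (@reds_apps (Dual T)) (rt_trans _ _ _ _ _ (reds_dual r1) r).
  rewrite (is_skipP e1) in r1; exists (apps Skip Ts); split.
  + exact: whnf_inert_apps.
  + apply: (@reds_apps (Dual T)).
    exact: rt_trans (reds_dual r1) (rt_step _ _ _ _ red_dual_skip).
  + by rewrite -eTs /nilp size_map; case: (Ts) => // *; rewrite is_skip_apps.
Qed.

Lemma whev_var0 (a : var) us n b : whev n (DVar a) us b <-> b = false.
Proof. by split=> [h|->]; [inversion h | constructor]. Qed.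

Lemma normalisesP (T : ty) :
  normalises T <-> exists n b, whev n (inst DVar T) [::] b.
Proof.
split=> [[W [w r]]|[n [b h]]]; last first.
  by have [//|//|W [h1 h2 _]] := @whev_reds _ _ _ _ T [::] h; exists W.
have {}r := clos_rt_rt1n _ _ _ _ r; elim: r w => [x|x y z r _ IH] w.
  by exists 0, (normal_form_is_skip x); apply: (whnf_whev _ whev_var0).
have [n [b h]] := IH w.
by have [m e] := red_whev whev_var0 r h; exists m, b.
Qed.

(** * The program *)

Definition ETag : expr := EHd EArg.
(* The i-th component of an argument [Cons _ (code_seq ts)]. *)
Definition EField (e : expr) (i : nat) : expr := EHd (iter i ETl (ETl e)).
Definition ENat (n : nat) : expr := EQuote (code_nat n).
Definition EIs (e : expr) (n : nat) : expr := EEq e (ENat n).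
Definition EAtom (n : nat) : expr := EQuote (node n [::]).
Definition EArr (e1 e2 : expr) : expr :=
  ECons (ENat 2) (ECons e1 (ECons e2 (EQuote Nil))).
Definition ECase (e : expr) (cases : seq (nat * expr)) (default : expr) : expr :=
  foldr (fun c r => EIf (EIs e c.1) c.2 r) default cases.

Definition MAIN := 0.
Definition INFER := 1.
Definition LOOKUP := 2.
Definition EVAL := 3.
Definition APPLY := 4.
Definition MATCH := 5.
Definition ARGS := 6.
Definition CONST := 7.
(** The language has no local definitions; passing the inferred patterns as an argument to a
    separate function binds them for repeated use. *)
Definition INFER_APP := 8.

(** A kind of a constant with asterisks is represented by a pattern, in which
    the atom 3 stands for either proper kind. *)
Definition EStar : expr := EAtom 3.

Definition body_main : expr :=
  EIf (ECall INFER (ECons (EHd EArg) (EHd (ETl EArg))))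
      (ECall MATCH (ECons (ECall INFER (ECons (EHd EArg) (EHd (ETl EArg))))
                          (EHd (ETl (ETl EArg)))))
      (EQuote Nil).

(* The argument is [Cons D T]; the result is [Nil] for an ill-formed type. *)
Definition body_infer : expr :=
  let D := EHd EArg in let T := ETl EArg in
  let rec_lam := ECall INFER (ECons
    (ECons (ECons (EField T 0) (EField T 1)) D) (EField T 2)) in
  ECase (EHd T)
    [:: (0, ECall CONST (EField T 0));
        (1, ETl (ECall LOOKUP (ECons (EField T 0) D)));
        (2, EIf rec_lam (EArr (EField T 1) rec_lam) (EQuote Nil))]
    (ECall INFER_APP (ECons (ECall INFER (ECons D (EField T 0)))
       (ECons (ECall INFER (ECons D (EField T 1))) T))).

(* The argument is [Cons P (Cons Q T)], with [P] and [Q] the patterns of the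
   two components of the application [T]. *)
Definition body_infer_app : expr :=
  let P := EHd EArg in let Q := EHd (ETl EArg) in let T := ETl (ETl EArg) in
  EIf (EIs (EHd P) 2)
    (EIf Q
      (EIf (ECall MATCH (ECons (EField P 0) Q))
        (EIf (ECall EVAL (ECons (EQuote Nil) T)) (EField P 1) (EQuote Nil))
        (EQuote Nil))
      (EQuote Nil))
    (EQuote Nil).

(* The argument is [Cons x l] with [l] an association list; the result is the
   first entry of [x], or [Nil]. *)
Definition body_lookup : expr :=
  EIf (ETl EArg)
    (EIf (EEq (EHd EArg) (EHd (EHd (ETl EArg))))
      (EHd (ETl EArg))
      (ECall LOOKUP (ECons (EHd EArg) (ETl (ETl EArg)))))
    (EQuote Nil).

(* The argument is [Cons P Q]. *)
Definition body_match : expr :=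
  let P := EHd EArg in let Q := ETl EArg in
  EIf (EIs (EHd P) 2)
    (EIf (EIs (EHd Q) 2)
      (EIf (ECall MATCH (ECons (EField P 0) (EField Q 0)))
        (ECall MATCH (ECons (EField P 1) (EField Q 1)))
        (EQuote Nil))
      (EQuote Nil))
    (EIf (EIs (EHd Q) 2)
      (EQuote Nil)
      (EIf (EIs (EHd P) 3)
        (EQuote (code_bool true))
        (EIf (EIs (EHd Q) 3) (EQuote (code_bool true)) (EEq P Q)))).

(* The argument is [Cons ls (Cons P R)]; the result is [P => ... => P => R],
   with one [P] for each element of [ls]. *)
Definition body_args : expr :=
  EIf (EHd EArg)
    (EArr (EHd (ETl EArg))
      (ECall ARGS (ECons (ETl (EHd EArg)) (ETl EArg))))
    (ETl (ETl EArg)).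

Definition body_const : expr :=
  let label_args P R := ECall ARGS (ECons (EField EArg 0) (ECons P R)) in
  let k := EField EArg 0 in
  let S := EAtom 0 in let T := EAtom 1 in
  ECase ETag
    [:: (0, EArr EStar (EArr EStar T));
        (1, label_args EStar T);
        (2, label_args EStar T);
        (3, EArr (EArr k k) k);
        (4, EArr (EArr k EStar) T);
        (5, S);
        (6, S);
        (7, EArr EStar S);
        (8, EArr EStar S);
        (9, EArr S (EArr S S));
        (10, label_args S S);
        (11, label_args S S)]
    (EArr S S).

(** [VOther] is the value of every normal form other than Skip, except for
    functions whose application may diverge or reach Skip. [VId] is the value of
    [Dual] and of [;T] for [T] equal to Skip, [VConstBot] that of [;T] for a
    diverging [T]. *)
Definition VBot : tree := Nil.
Definition VSkip : tree := node 0 [::].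
Definition VOther : tree := node 1 [::].
Definition VId : tree := node 2 [::].
Definition VSeq : tree := node 3 [::].
Definition VMu : tree := node 4 [::].
Definition VConstBot : tree := node 5 [::].
Definition VClosure (a body env : tree) : tree :=
  Cons (code_nat 6) (Cons a (Cons body env)).

(* The argument is [Cons env T], with [env] an association list; a variable
   without a value is free in the type under consideration. *)
Definition body_eval : expr :=
  let env := EHd EArg in let T := ETl EArg in
  let var := ECall LOOKUP (ECons (EField T 0) env) in
  ECase (EHd T)
    [:: (0, ECase (EHd (EField T 0))
              [:: (3, EQuote VMu); (5, EQuote VSkip); (9, EQuote VSeq);
                  (12, EQuote VId)]
              (EQuote VOther));
        (1, EIf var (ETl var) (EQuote VOther));
        (2, ECons (ENat 6) (ECons (EField T 0) (ECons (EField T 2) env)))]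
    (ECall APPLY (ECons (ECall EVAL (ECons env (EField T 0)))
                        (ECall EVAL (ECons env (EField T 1))))).

(* The argument is [Cons v u]. *)
Definition body_apply : expr :=
  let v := EHd EArg in let u := ETl EArg in
  ECase (EHd v)
    [:: (2, u);
        (3, EIf u (EIf (EEq u (EQuote VSkip)) (EQuote VId) (EQuote VOther))
                  (EQuote VConstBot));
        (4, ECall APPLY (ECons u (EQuote VBot)));
        (5, EQuote VBot);
        (6, ECall EVAL (ECons
              (ECons (ECons (EHd (ETl v)) u) (ETl (ETl (ETl v))))
              (EHd (ETl (ETl v)))))]
    (EQuote VOther).

Definition prog : program :=
  [:: body_main; body_infer; body_lookup; body_eval; body_apply; body_match;
      body_args; body_const; body_infer_app].

(** * Symbolic execution of the program *)

Definition exec (f : nat) (x v : tree) : Prop :=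
  eval prog x (nth EArg prog f) v.

Lemma exec_det (f : nat) (x v w : tree) : exec f x v -> exec f x w -> v = w.
Proof. exact: eval_det. Qed.

(** Lets [run] build whatever result it finds, to be compared with the expected one afterwards. *)
Lemma eval_eq (x v w : tree) (e : expr) : eval prog x e v -> v = w -> eval prog x e w.
Proof. by move=> h <-. Qed.

Lemma eval_if (x : tree) (e e1 e2 : expr) (v w : tree) (b : bool) :
  eval prog x e v -> (if b then v <> Nil else v = Nil) ->
  eval prog x (if b then e1 else e2) w -> eval prog x (EIf e e1 e2) w.
Proof.
move=> h; case: b => hb hw; first exact: ev_if_true h hb hw.
by rewrite hb in h; apply: ev_if_false h hw.
Qed.

Lemma eval_eqb (x v1 v2 : tree) (e1 e2 : expr) (b : bool) :
  eval prog x e1 v1 -> eval prog x e2 v2 -> (if b then v1 = v2 else v1 <> v2) ->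
  eval prog x (EEq e1 e2) (code_bool b).
Proof.
case: b => h1 h2 e; last exact: ev_neq h1 h2 e.
by rewrite e in h1; apply: ev_eq h1 h2.
Qed.

Lemma eval_call (x v w : tree) (f : nat) (e : expr) :
  f < size prog -> eval prog x e v -> exec f v w -> eval prog x (ECall f e) w.
Proof.
move=> lt_f h1 h2; apply: ev_call h1 _ h2.
by move: lt_f; do 9 (case: f => [|f] //).
Qed.

(** The results of calls are taken from the context, and conditions must be
    decided by computation. *)
Ltac run :=
  lazymatch goal with
  | |- exec _ _ _ => eassumption
  | |- eval _ _ EArg _ => apply: ev_arg
  | |- eval _ _ (EQuote _) _ => apply: ev_quote
  | |- eval _ _ (ECons _ _) _ => eapply ev_cons; [run | run]
  | |- eval _ _ (EHd _) _ => eapply ev_hd; run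
  | |- eval _ _ (ETl _) _ => eapply ev_tl; run
  | |- eval _ _ (EEq _ _) _ =>
      first [ eapply (@eval_eqb _ _ _ _ _ true); [run | run | cbn; reflexivity]
            | eapply (@eval_eqb _ _ _ _ _ false); [run | run | cbn; first [discriminate | assumption]] ]
  | |- eval _ _ (EIf _ _ _) _ =>
      first [ eapply (@eval_if _ _ _ _ _ _ true); [run | cbn; first [discriminate | assumption] | cbn iota; run]
            | eapply (@eval_if _ _ _ _ _ _ false); [run | cbn; reflexivity | cbn iota; run] ]
  | |- eval _ _ (ECall _ _) _ => eapply eval_call; [reflexivity | run | cbn; run]
  end.

Ltac exec_unfold :=
  lazymatch goal with |- exec ?f ?x ?v =>
    let e := eval vm_compute in (nth EArg prog f) in change (eval prog x e v)
  end.

Ltac exec_run := exec_unfold; eapply eval_eq; [run | try reflexivity].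

Lemma code_nat_inj : injective code_nat.
Proof. by elim=> [|n IH] [|m] //= [/IH ->]. Qed.

Definition code_env (r : seq (var * tree)) : tree :=
  code_seq [seq Cons (code_nat b.1) b.2 | b <- r].

Fixpoint look (r : seq (var * tree)) (a : var) : option tree :=
  if r is (b, v) :: r' then if a == b then Some v else look r' a else None.

Lemma exec_lookup (r : seq (var * tree)) (a : var) :
  exec LOOKUP (Cons (code_nat a) (code_env r))
    (oapp (Cons (code_nat a)) Nil (look r a)).
Proof.
elim: r => [|[b v] r IH] /=; first by exec_run.
case: eqP => [->|/eqP ab]; first by exec_run.
have {}ab : code_nat a <> code_nat b by move=> /code_nat_inj e; rewrite e eqxx in ab.
by exec_run.
Qed.

(** * Kind patterns *)

Inductive kpat : Type :=
| PS
| PT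
| PStar
| PArr of kpat & kpat.

Fixpoint code_kpat (P : kpat) : tree :=
  match P with
  | PS => node 0 [::]
  | PT => node 1 [::]
  | PStar => node 3 [::]
  | PArr P1 P2 => node 2 [:: code_kpat P1; code_kpat P2]
  end.

Lemma code_kpat_neq_Nil (P : kpat) : code_kpat P <> Nil.
Proof. by case: P. Qed.

Fixpoint instance (P : kpat) (k : kind) : bool :=
  match P, k with
  | PS, KS | PT, KT => true
  | PStar, _ => proper k
  | PArr P1 P2, KArr k1 k2 => instance P1 k1 && instance P2 k2
  | _, _ => false
  end.

Fixpoint compatible (P Q : kpat) : bool :=
  match P, Q with
  | PArr P1 P2, PArr Q1 Q2 => compatible P1 Q1 && compatible P2 Q2
  | PArr _ _, _ | _, PArr _ _ => false
  | PStar, _ | _, PStar | PS, PS | PT, PT => true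
  | _, _ => false
  end.

Fixpoint kpat_of (k : kind) : kpat :=
  match k with
  | KS => PS
  | KT => PT
  | KArr k1 k2 => PArr (kpat_of k1) (kpat_of k2)
  end.

Lemma code_kpat_of (k : kind) : code_kpat (kpat_of k) = code_kind k.
Proof. by elim: k => //= k1 -> k2 ->. Qed.

Lemma instance_inhabited (P : kpat) : exists k, instance P k.
Proof.
elim: P => [|||P [k1 h1] Q [k2 h2]]; [by exists KS | by exists KT | by exists KS |].
by exists (KArr k1 k2); rewrite /= h1.
Qed.

(** The occurrences of [PStar] are independent of each other, so common instances of the components
    always combine into one of the whole. *)
Lemma compatibleP (P Q : kpat) :
  compatible P Q <-> exists k, instance P k /\ instance Q k.
Proof.
elim: P Q => [|||P1 IH1 P2 IH2] [|||Q1 Q2] /=; split=> //;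
  try by [move=> _; exists KS | move=> _; exists KT | case=> -[|| ? ?] []].
  case/andP=> /IH1[k1 [h1 h2]] /IH2[k2 [h3 h4]]; exists (KArr k1 k2).
  by rewrite h1 h2 h3 h4.
case=> -[|| k1 k2] [] // /andP[h1 h2] /andP[h3 h4]; apply/andP; split.
  by apply/IH1; exists k1.
by apply/IH2; exists k2.
Qed.

Lemma instance_kpat_of (k k' : kind) : instance (kpat_of k) k' <-> k = k'.
Proof.
elim: k k' => [||k1 IH1 k2 IH2] [||k1' k2'] //=; split=> //.
  by case/andP => /IH1 -> /IH2 ->.
by case=> <- <-; apply/andP; split; [apply/IH1 | apply/IH2].
Qed.

Lemma compatible_kpat_of (P : kpat) (k : kind) :
  compatible P (kpat_of k) <-> instance P k.
Proof.
rewrite compatibleP; split=> [[k' [h /instance_kpat_of ->]] //|h].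
by exists k; split=> //; apply/instance_kpat_of.
Qed.

Lemma exec_match (P Q : kpat) :
  exec MATCH (Cons (code_kpat P) (code_kpat Q)) (code_bool (compatible P Q)).
Proof.
elim: P Q => [|||P1 IH1 P2 IH2] [|||Q1 Q2]; try exec_run.
have := IH1 Q1; have := IH2 Q2 => /=.
by case: (compatible P1 Q1) => h1 h2; exec_run.
Qed.

(** * Kinds of constants *)

Lemma exec_args (ls : seq label) (P R : kpat) :
  exec ARGS (Cons (code_seq (map code_nat ls)) (Cons (code_kpat P) (code_kpat R)))
    (code_kpat (iter (size ls) (PArr P) R)).
Proof. by elim: ls => [|l ls IH] /=; exec_run. Qed.

Definition const_kpat (c : const) : kpat :=
  match c with
  | CArrow => PArr PStar (PArr PStar PT)
  | CRecord ls | CVariant ls => iter (size ls) (PArr PStar) PT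
  | CMu k => let P := kpat_of k in PArr (PArr P P) P
  | CForall k => PArr (PArr (kpat_of k) PStar) PT
  | CSkip | CEnd => PS
  | CIn | COut => PArr PStar PS
  | CSeq => PArr PS (PArr PS PS)
  | CExternal ls | CInternal ls => iter (size ls) (PArr PS) PS
  | CDual => PArr PS PS
  end.

Lemma exec_const (c : const) : exec CONST (code_const c) (code_kpat (const_kpat c)).
Proof.
case: c => [|ls|ls|k|k||||||ls|ls|];
  try (have ? := exec_args ls PStar PT); try (have ? := exec_args ls PS PS);
  exec_run; by rewrite /= ?code_kpat_of.
Qed.

Lemma instance_iter (P R : kpat) (n : nat) (k : kind) :
  instance (iter n (PArr P) R) k <->
  exists ks k', [/\ size ks = n, all (instance P) ks, instance R k' & k = foldr KArr k' ks].
Proof.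
elim: n k => [|n IH] k /=.
  by split=> [h|[ks [k' [/size0nil -> _ h ->]]]] //; exists [::], k.
case: k => [||k1 k2]; try by split=> // -[[|? ?] [? []]].
split=> [/andP[h1 /IH[ks [k' [h2 h3 h4 ->]]]]|].
  by exists (k1 :: ks), k'; rewrite /= h2 h1.
case=> -[|k0 ks] [k' [//= [h2] /andP[h1 h3] h4 [-> ->]]].
by rewrite h1; apply/IH; exists ks, k'.
Qed.

Lemma const_kpatP (c : const) (k : kind) : instance (const_kpat c) k <-> const_kind c k.
Proof.
have fS n ks : size ks = n -> all (instance PS) ks -> ks = nseq n KS.
  by move=> <-; elim: ks => [|[] ks IH] //= /IH {1}->.
split.
  case: c => [|ls|ls|k0|k0||||||ls|ls|]; rewrite /const_kpat.
  - case: k => [|| k1 [|| k2 []]] //=; rewrite ?andbF // andbT => /andP[]; exact: ck_arrow.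
  - by case/instance_iter => ks [k' [h1 h2 + ->]]; case: k' => // _; constructor.
  - by case/instance_iter => ks [k' [h1 h2 + ->]]; case: k' => // _; constructor.
  - case: k => [|| [|| k1 k2] k3] //= /andP[/andP[]].
    by do 3 move/instance_kpat_of => <-; constructor.
  - case: k => [|| [|| k1 k2] []] //=; rewrite ?andbF // andbT => /andP[].
    by move/instance_kpat_of => <- h; constructor.
  - by case: k => // _; constructor.
  - by case: k => // _; constructor.
  - by case: k => [|| k1 []] //=; rewrite ?andbF // andbT; constructor.
  - by case: k => [|| k1 []] //=; rewrite ?andbF // andbT; constructor.
  - by case: k => [|| [] [|| [] []]] //= _; constructor.
  - by case/instance_iter => ks [k' [h1 /(fS _ _ h1) -> + ->]]; case: k' => // _; constructor.
  - by case/instance_iter => ks [k' [h1 /(fS _ _ h1) -> + ->]]; case: k' => // _; constructor.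
  - by case: k => [|| [] []] //= _; constructor.
have kk k' : instance (kpat_of k') k' by apply/instance_kpat_of.
case=> {c k} //=.
- by move=> k1 k2 -> ->.
- by move=> ls ks h1 h2; apply/instance_iter; exists ks, KT.
- by move=> ls ks h1 h2; apply/instance_iter; exists ks, KT.
- by move=> k; rewrite kk.
- by move=> k k1 ->; rewrite kk.
- by move=> k ->.
- by move=> k ->.
- move=> ls; apply/instance_iter; exists (nseq (size ls) KS), KS.
  by rewrite size_nseq all_nseq orbT.
- move=> ls; apply/instance_iter; exists (nseq (size ls) KS), KS.
  by rewrite size_nseq all_nseq orbT.
Qed.

(** * Adequacy of the interpreter *)

Definition tree_eq_dec (t u : tree) : {t = u} + {t <> u}.
Proof. by decide equality. Defined.

(** What is observable of a value in the flat domain: [None] for divergence, otherwise whether the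
    normal form is [Skip]. Closures count as other normal forms. *)
Definition value_class (v : tree) : option bool :=
  if v is Nil then None else Some (if tree_eq_dec v VSkip then true else false).

(** The two halves are deliberately asymmetric: the value must account for evaluations with at most
    [n] unfoldings, whereas an evaluation that it predicts may take any number. *)
Definition agree (n : nat) (t : dty) (v : tree) : Prop :=
  (forall b, whev n t [::] b -> value_class v = Some b) /\
  (forall b, value_class v = Some b -> exists m, whev m t [::] b).

(** The logical relation. Its arrow clause demands a result of [APPLY], hence termination of the
    interpreter, and ranges over smaller indices to make the relation downward closed. *)
Fixpoint R (k : kind) (n : nat) (t : dty) (v : tree) : Prop :=
  agree n t v /\
  if k is KArr k1 k2 then
    forall m u x, m <= n -> R k1 m u x ->
      exists2 w, exec APPLY (Cons v x) w & R k2 m (DApp t u) w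
  else True.

Lemma R_agree (k : kind) (n : nat) (t : dty) (v : tree) : R k n t v -> agree n t v.
Proof. by case: k => [||k1 k2] []. Qed.

Lemma R_proper (k : kind) (n : nat) (t : dty) (v : tree) :
  proper k -> R k n t v <-> agree n t v.
Proof. by case: k => //= _; split=> [[]|]. Qed.

Lemma R_down (k : kind) (n m : nat) (t : dty) (v : tree) :
  m <= n -> R k n t v -> R k m t v.
Proof.
move=> le_mn r; have [h1 h2] := R_agree r.
have h : agree m t v by split=> // b /(whev_mono le_mn)/h1.
case: k r => [||k1 k2] [_ h3]; split=> //.
by move=> j u x le_jm; apply: h3; apply: leq_trans le_jm le_mn.
Qed.

Lemma R_expand (k : kind) (n : nat) (t t' : dty) (v : tree) :
  (forall m us b, whev m t us b <-> whev m t' us b) -> R k n t v -> R k n t' v.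
Proof.
elim: k n t t' v => [||k1 _ k2 IH] n t t' v e [[h1 h2] h3];
  (split; first by split=> [b /e/h1 | b /h2[m /e]] //; exists m) => //.
move=> m u x le_mn ru; have [w h4 h5] := h3 m u x le_mn ru.
by exists w => //; apply: (IH _ _ _ _ _ h5) => j us b; rewrite !whev_appE.
Qed.

(** A term that converges on every list of arguments, and never to [Skip], behaves like [VOther] at
    every kind, since [APPLY] maps [VOther] to itself. *)
Lemma R_other (k : kind) (n : nat) (t : dty) :
  (forall m us b, whev m t us b -> b = false) ->
  (forall us, exists m, whev m t us false) -> R k n t VOther.
Proof.
elim: k t n => [||k1 _ k2 IH] t n h1 h2;
  (split; first by split=> [b /h1 -> | _ [<-]]) => //.
move=> m u x le_mn _; exists VOther; first by exec_run.
apply: IH => [j us b /whev_appE/h1 // | us].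
by have [j h] := h2 (u :: us); exists j; apply/whev_appE.
Qed.

Lemma agree_whev (n m : nat) (t : dty) (v : tree) (b : bool) :
  value_class v = Some b -> whev m t [::] b -> agree n t v.
Proof.
move=> hv h; split=> c; last by rewrite hv => -[<-]; exists m.
by move=> h'; rewrite hv (whev_det h h').
Qed.

Lemma R_dual (n : nat) : R (KArr KS KS) n (DCon CDual) VId.
Proof.
split; first by apply: (@agree_whev _ 0 _ _ false) => //; constructor.
move=> m u x _ [[h1 h2] _]; exists x; first by exec_run.
split=> //; split=> b.
  by move=> /whev_appE/whev_dualE[c /h1 -> ->]; rewrite andbT.
move=> /h2[j h]; exists j; apply/whev_appE/whev_dualE; exists b => //.
by rewrite andbT.
Qed.

Lemma R_seq (n : nat) : R (KArr KS (KArr KS KS)) n (DCon CSeq) VSeq.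
Proof.
split; first by apply: (@agree_whev _ 0 _ _ false) => //; constructor.
have base m t v : value_class v = Some false -> agree m (DApp (DCon CSeq) t) v.
  by move=> hv; apply: (agree_whev (m := 0) _ hv); do 2 constructor.
move=> m t v _ [[h1 h2] _].
case: (tree_eq_dec v Nil) => [e|nb].
  (* With one argument [;] is already normal even if that argument diverges, so the value is not
     [VBot]; divergence shows at the second argument. *)
  subst v; exists VConstBot; first by exec_run.
  split; first exact: base.
  move=> j u x le_jm _; exists VBot; first by exec_run.
  split=> //; split=> // b /whev_appE/whev_appE/whev_seqE[[]|[]] /(whev_mono le_jm)/h1 //.
case: (tree_eq_dec v VSkip) => [e|ns].
  subst v; exists VId; first by exec_run.
  split; first exact: base.
  move=> j u x le_jm [[h3 h4] _]; exists x; first by exec_run.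
  split=> //; split=> b.
    move=> /whev_appE/whev_appE/whev_seqE[[_ /h3] //|[]].
    by move/(whev_mono le_jm)/h1.
  move=> /h4[i hi]; have [i' hi'] := h2 _ (erefl _).
  exists (maxn i i'); apply/whev_appE/whev_appE/whev_seqE; left.
  by split; [apply: whev_mono hi' | apply: whev_mono hi]; rewrite ?leq_maxl ?leq_maxr.
have hv : value_class v = Some false.
  by rewrite /value_class; case: (v) nb ns => // *; case: tree_eq_dec.
exists VOther.
  case: v nb ns {h1 h2 hv} => // v1 v2 _ ns; exec_run.
have [i hi] := h2 _ hv.
apply: R_other => [j us b /whev_appE|[|u us]].
- case: us => [|u us] h; first by inversion h.
  move/whev_seqE: h => [[h _]|[] //].
  by have := whev_det h hi.
- by exists 0; do 2 constructor.
- by exists i; apply/whev_appE/whev_seqE; right.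
Qed.

(** Since the values of a proper kind form a flat domain, the least fixed point
    of [F] is already [F VBot]. *)
Lemma R_mu (k : kind) (n : nat) : proper k ->
  R (KArr (KArr k k) k) n (DCon (CMu k)) VMu.
Proof.
move=> pk; split; first by apply: (@agree_whev _ 0 _ _ false) => //; constructor.
move=> n' t v _ [_ rv]; set X := DApp (DCon (CMu k)) t.
have unfold m b : whev m.+1 X [::] b <-> whev m (DApp t X) [::] b.
  rewrite whev_appE whev_appE; split=> h; first by inversion h.
  by constructor.
(* Without unfoldings [X] has no evaluation, so at index 0 it is related to [VBot]; this gives the
   candidate value [w] of the fixed point. *)
have none b : ~ whev 0 X [::] b by move/whev_appE => h; inversion h.
have bot : agree 0 X VBot by split=> // b /none.
have [w hw rw] := rv 0 X VBot isT (proj2 (R_proper _ _ _ pk) bot).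
exists w; first by exec_run.
have sound b : value_class w = Some b -> exists m, whev m X [::] b.
  by move/(proj2 (R_agree rw)) => [m h]; exists m.+1; apply/unfold.
apply/(R_proper _ _ _ pk); split=> //.
have: n' <= n' by [].
(* Induction on the number of unfoldings. If [w] is not [VBot], soundness and determinism settle the
   claim. If it is, [IH] shows that [X] has no evaluation within [m] unfoldings and is thus related
   to [VBot] at [m]; applying [t] to it yields the same [w] and covers one more unfolding. *)
elim: {1 3}n' => [_ b /none // | m IH lt_m b h].
have {}IH := IH (ltnW lt_m).
case e: (value_class w) => [c|].
  by have [j h'] := sound _ e; rewrite (whev_det h h').
have w0 : w = VBot by case: (w) e.
have rX : R k m X VBot by apply/(R_proper _ _ _ pk); split=> // c /IH; rewrite e.
have [w' hw' rw'] := rv m X VBot (ltnW lt_m) rX.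
by rewrite -e (exec_det hw hw'); apply: (proj1 (R_agree rw')); apply/unfold.
Qed.

Definition const_value (c : const) : tree :=
  match c with
  | CSkip => VSkip
  | CSeq => VSeq
  | CMu _ => VMu
  | CDual => VId
  | _ => VOther
  end.

Lemma R_const (c : const) (k : kind) (n : nat) :
  const_kind c k -> mu_proper (Con c) -> R k n (DCon c) (const_value c).
Proof.
move=> ck mc.
have inert : weak_head_inert c -> ~~ is_skip c -> R k n (DCon c) VOther.
  move=> ic ns; apply: R_other => [m us b|us].
    by rewrite whev_inertE // (negbTE ns).
  by exists 0; rewrite whev_inertE // (negbTE ns).
case: ck mc inert; try by move=> *; auto.
- by move=> k' pk _; apply: R_mu.
- move=> _ _; split=> //; split=> b; first by rewrite whev_inertE // => ->.
  by case=> <-; exists 0; apply/whev_inertE.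
- by move=> _ _; apply: R_seq.
- by move=> _ _; apply: R_dual.
Qed.

Definition env_value (r : seq (var * tree)) (a : var) : tree := odflt VOther (look r a).

(** The fundamental lemma of the logical relation, by induction on the derivation. For an
    abstraction, the extended environment matches [dupd], and [R_expand] absorbs the beta step. *)
Lemma eval_R (D : ctx) (T : ty) (k : kind) : has_kind D T k -> mu_proper T ->
  forall (n : nat) (s : var -> dty) (r : seq (var * tree)),
    (forall a k', lookup D a = Some k' -> R k' n (s a) (env_value r a)) ->
    exists2 v, exec EVAL (Cons (code_env r) (code_ty T)) v & R k n (inst s T) v.
Proof.
elim=> {D T k}.
- move=> D c k ck mc n s r _; exists (const_value c); last exact: R_const.
  by case: c {ck mc} => [|ls|ls|k'|k'||||||ls|ls|]; exec_run.
- move=> D a k Da _ n s r hs; exists (env_value r a); last exact: hs.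
  have := exec_lookup r a; rewrite /env_value; case: (look r a) => [v|] /= h; exec_run.
- move=> D a k k' T _ IH mT n s r hs.
  exists (VClosure (code_nat a) (code_ty T) (code_env r)); first by exec_run.
  split; first by apply: (@agree_whev _ 0 _ _ false) => //; constructor.
  move=> m u x le_mn ru.
  have [b k1|v hv rv] := IH mT m (dupd s a u) ((a, x) :: r).
    rewrite /= /dupd /env_value /=; case: eqP => [_ [<-] //|_ Db].
    exact: R_down le_mn (hs _ _ Db).
  exists v; first by exec_run.
  apply: R_expand rv => j us b; rewrite -dsubst1_inst whev_appE.
  by split=> h; [constructor | inversion h].
- move=> D T U k k' _ IHT _ IHU _ /andP[mT mU] n s r hs.
  have [v hv [_ rv]] := IHT mT n s r hs.
  have [x hx rx] := IHU mU n s r hs.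
  have [w hw rw] := rv n _ _ (leqnn n) rx.
  by exists w => //; exec_run.
Qed.

Lemma R_var (k : kind) (n : nat) (i : nat) : R k n (DVar i) VOther.
Proof. by apply: R_other => [m us b /whev_var0 | us] //; exists 0; constructor. Qed.

Lemma eval_normalises (D : ctx) (T : ty) (k : kind) :
  has_kind D T k -> mu_proper T ->
  forall n, exists2 v, exec EVAL (Cons Nil (code_ty T)) v & R k n (inst DVar T) v.
Proof.
by move=> hT mT n; apply: (eval_R hT mT (r := [::])) => a k' _; apply: R_var.
Qed.

(** Decides the normalisation premise of [hk_app], and therefore assumes kinds only for the two
    components. *)
Lemma exec_eval_app (D : ctx) (T U : ty) (k k' : kind) :
  has_kind D T (KArr k k') -> has_kind D U k -> mu_proper (App T U) ->
  exists2 v, exec EVAL (Cons Nil (code_ty (App T U))) v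
    & normalises (App T U) <-> v <> Nil.
Proof.
move=> hT hU /= /andP[mT mU].
have val n : exists2 v, exec EVAL (Cons Nil (code_ty (App T U))) v &
    agree n (inst DVar (App T U)) v.
  have [v hv [_ rv]] := eval_normalises hT mT n.
  have [x hx rx] := eval_normalises hU mU n.
  have [w hw /R_agree rw] := rv n _ _ (leqnn n) rx.
  by exists w => //; exec_run.
have [v hv [_ h]] := val 0; exists v => //; rewrite normalisesP.
(* The index must be the number of unfoldings in the given evaluation; the value found at that index
   is [v] again because the program is deterministic. *)
split=> [[n [b e]] v0|nv].
  have [w hw [h' _]] := val n; have := h' b e.
  by rewrite (exec_det hw hv) v0.
case e: (value_class v) => [b|]; last by case: (v) e nv.
by have [m] := h b e; exists m, b.
Qed.

(** * Correctness of kind inference and of the decision procedure *)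

Definition code_kpat_option (P : option kpat) : tree := oapp code_kpat Nil P.

Lemma look_ctx (D : ctx) (a : var) :
  look [seq (b.1, code_kind b.2) | b <- D] a = omap code_kind (lookup D a).
Proof. by elim: D => //= -[b k] D IH; case: eqP. Qed.

Lemma code_ctxE (D : ctx) : code_ctx D = code_env [seq (b.1, code_kind b.2) | b <- D].
Proof. by rewrite /code_ctx /code_env -map_comp. Qed.

Lemma has_kind_con (D : ctx) (c : const) (k : kind) :
  has_kind D (Con c) k <-> const_kind c k.
Proof. by split=> [h|]; [inversion h | apply: hk_con]. Qed.

Lemma has_kind_var (D : ctx) (a : var) (k : kind) :
  has_kind D (Var a) k <-> lookup D a = Some k.
Proof. by split=> [h|]; [inversion h | apply: hk_var]. Qed.

Lemma has_kind_lam (D : ctx) (a : var) (k : kind) (T : ty) (k' : kind) :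
  has_kind D (Lam a k T) k' <->
  exists2 k2, k' = KArr k k2 & has_kind ((a, k) :: D) T k2.
Proof.
split=> [h|[k2 ->]]; last exact: hk_lam.
by inversion h; subst; exists k'0.
Qed.

Lemma has_kind_app (D : ctx) (T U : ty) (k' : kind) :
  has_kind D (App T U) k' <->
  exists k, [/\ has_kind D T (KArr k k'), has_kind D U k & normalises (App T U)].
Proof.
split=> [h|[k [h1 h2 h3]]]; last exact: hk_app h1 h2 h3.
by inversion h; subst; exists k.
Qed.

(** The kinds of a type are either none or exactly the instances of one pattern. Application
    preserves this: by independence of the stars, choosing an argument kind does not restrict the
    instances of the codomain. *)
Lemma infer_correct (D : ctx) (T : ty) : mu_proper T ->
  exists2 P, exec INFER (Cons (code_ctx D) (code_ty T)) (code_kpat_option P)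
    & forall k, has_kind D T k <-> exists2 Q, P = Some Q & instance Q k.
Proof.
elim: T D => [c|a|a k T IH|T IHT U IHU] D.
- move=> _; exists (Some (const_kpat c)).
    by have h := exec_const c; exec_run.
  move=> k; rewrite has_kind_con -const_kpatP.
  by split=> [h|[_ [<-]] //]; exists (const_kpat c).
- move=> _; exists (omap kpat_of (lookup D a)).
    have := exec_lookup [seq (b.1, code_kind b.2) | b <- D] a.
    rewrite -code_ctxE look_ctx; case: (lookup D a) => [k|] /= h; exec_run.
    by rewrite /= code_kpat_of.
  move=> k; rewrite has_kind_var; case: (lookup D a) => [k'|] /=.
    split=> [[->]|[_ [<-] /instance_kpat_of -> //]].
    by exists (kpat_of k) => //; apply/instance_kpat_of.
  by split=> // -[].
- move=> /= mT; have [P h hP] := IH ((a, k) :: D) mT.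
  exists (omap (PArr (kpat_of k)) P).
    case: P h {hP} => [P|] /= h; last by exec_run.
    by have nP := @code_kpat_neq_Nil P; exec_run; rewrite /= code_kpat_of.
  move=> k'; rewrite has_kind_lam; split=> [[k2 -> /hP[Q -> hQ]]|].
    exists (PArr (kpat_of k) Q) => //=; rewrite hQ andbT; exact/instance_kpat_of.
  case: P h hP => [P|] h hP [Q] //= [<-]; case: k' => //= k1 k2 /andP[].
  by move/instance_kpat_of <- => h2; exists k2 => //; apply/hP; exists P.
- move=> mTU; move: (mTU) => /= /andP[mT mU].
  have [P hT hP] := IHT D mT; have [Q hU hQ] := IHU D mU.
  suff [S hS hTU] : exists2 S,
      exec INFER_APP (Cons (code_kpat_option P) (Cons (code_kpat_option Q)
        (code_ty (App T U)))) (code_kpat_option S) &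
      forall k, has_kind D (App T U) k <-> exists2 S', S = Some S' & instance S' k.
    by exists S => //; exec_run.
  case: P hT hP => [P|] hT hP; last first.
    exists None; first by exec_run.
    by move=> k; split=> [/has_kind_app[? [/hP[]]]|[]].
  case: P hT hP => [|||P1 P2] hT hP; [| | |].
  1-3: exists None; first by exec_run.
  1-3: by move=> k; split=> [/has_kind_app[? [/hP[? [<-]]]]|[]].
  case: Q hU hQ => [Q|] hU hQ; last first.
    exists None; first by exec_run.
    by move=> k; split=> [/has_kind_app[? [_ /hQ[]]]|[]].
  have hm := exec_match P1 Q; have nQ := @code_kpat_neq_Nil Q.
  case e: (compatible P1 Q) hm => hm; last first.
    exists None; first by exec_run.
    move=> k; split=> [/has_kind_app[k1 [/hP[_ [<-] /= /andP[i1 _]] /hQ[_ [<-] i2] _]]|[] //].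
    by have := proj2 (compatibleP P1 Q) (ex_intro _ _ (conj i1 i2)); rewrite e.
  have [k1 [i1 i2]] := proj1 (compatibleP P1 Q) e.
  (* Normalisation does not mention kinds, so adequacy may be applied at any instance of the
     pattern. *)
  have [k2 i3] := instance_inhabited P2.
  have kT k : instance P2 k -> has_kind D T (KArr k1 k).
    by move=> i; apply/hP; exists (PArr P1 P2); rewrite //= i1.
  have kU : has_kind D U k1 by apply/hQ; exists Q.
  have [v hv nv] := exec_eval_app (kT _ i3) kU mTU.
  case: (tree_eq_dec v Nil) => v0.
    exists None; first by subst v; exec_run.
    by move=> k; split=> [/has_kind_app[? [_ _ /nv]]|[]].
  exists (Some P2); first by case: v v0 hv {nv} => // v1 v2 _ hv; exec_run.
  move=> k; split=> [/has_kind_app[k' [/hP[_ [<-] /= /andP[_ i]] _ _]]|[_ [<-] i]].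
    by exists P2.
  by apply: hk_app (kT _ i) kU _; apply/nv.
Qed.

Theorem theorem2 :
  exists p : program,
    forall (D : ctx) (T : ty) (k : kind),
      renamed T -> mu_proper T ->
      exists b : bool,
        returns p (code_input D T k) (code_bool b) /\
        (b = true <-> has_kind D T k).
Proof.
exists prog => D T k _ mT; have [P hT hP] := infer_correct D mT.
suff [b hb e] : exists2 b, exec MAIN (code_input D T k) (code_bool b) &
    b <-> has_kind D T k.
  by exists b; split=> //; apply: ev_call hb => //; apply: ev_arg.
case: P hT hP => [P|] hT hP; last first.
  exists false; first by exec_run.
  by rewrite hP; split=> // -[].
(* The pattern [kpat_of k] has [k] as its only instance, so compatibility with it amounts to [k]
   being an instance of [P]. *)
exists (compatible P (kpat_of k)).
  have := exec_match P (kpat_of k); rewrite code_kpat_of => hm.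
  by have nP := @code_kpat_neq_Nil P; exec_run.
rewrite compatible_kpat_of hP; split=> [|[_ [<-]]] //; by exists P.
Qed.
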